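(* Let $G$ be a topological group and let $\mathcal A(G)$ be a subalgebra of $\mathcal{LUC}(G)$. If $T_1$ and $T_2$ are approximable $\mathcal A(G)$-interpolation sets and $T_1\cup T_2$ is right uniformly discrete, then $T_1\cup T_2$ is an approximable $\mathcal A(G)$-interpolation set.
   Context: Let $e$ be the identity of $G$. $\mathcal{LUC}(G)$ is the algebra of bounded $f:G\to\mathbb C$ such that for every $\epsilon>0$ there is a neighbourhood $U$ of $e$ with $|f(s)-f(t)|<\epsilon$ whenever $st^{-1}\in U$. $T\subseteq G$ is an approximable $\mathcal A(G)$-interpolation set if every bounded $f:T\to\mathbb C$ extends to a function in $\mathcal A(G)$ and, for every neighbourhood $U$ of $e$, there are open neighbourhoods $V_1,V_2$ of $e$ with $\overline{V_1}\subseteq V_2\subseteq U$ such that for each $S\subseteq T$ there is $h\in\mathcal A(G)$ with $h(V_1S)\subseteq\{1\}$ and $h(G\setminus V_2S)\subseteq\{0\}$. $T$ is right uniformly discrete if there is a neighbourhood $V$ of $e$ with $Vs\cap Vs'=\emptyset$ for all $s\ne s'$ in $T$. *)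

(* Defs.v *)
From HB Require Import structures.
From mathcomp Require Import all_boot all_order all_algebra.
From mathcomp Require Import complex.
From mathcomp Require Import all_classical all_reals all_analysis.

Set Implicit Arguments.
Unset Strict Implicit.
Unset Printing Implicit Defensive.

Import Order.TTheory GRing.Theory Num.Theory.
Import numFieldNormedType.Exports.

Local Open Scope classical_set_scope.
Local Open Scope complex_scope.
Local Open Scope ring_scope.

(* Written multiplicatively; not necessarily abelian, and not assumed Hausdorff. *)
HB.mixin Record isTopologicalGroup G & Topological G & Group G := {
  mulg_continuous : continuous (fun x : G * G => (x.1 * x.2)%g) ;
  invg_continuous : continuous (fun x : G => (x^-1)%g)
}.

#[short(type="topologicalGroupType")]
HB.structure Definition TopologicalGroup :=
  {G of Topological G & Group G & isTopologicalGroup G}.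

Definition setmulg (G : groupType) (A B : set G) : set G :=
  [set (x * y)%g | x in A & y in B].

Definition LUC (R : realType) (G : topologicalGroupType) : set (G -> R[i]) :=
  [set f | [bounded (f x : R[i]^o) | x in [set: G]] /\
    forall eps : R, 0 < eps ->
      exists2 U : set G, nbhs (1%g : G) U &
        forall s t : G, U (s * t^-1)%g -> `|f s - f t| < eps%:C].
Arguments LUC : clear implicits.

(* The operations on [G -> R[i]] are the pointwise ones; a subalgebra need not
   contain the constant function 1, nor be closed under conjugation or uniform
   limits. *)
Definition subalgebra (R : realType) (G : Type) (A : set (G -> R[i])) : Prop :=
  GRing.submod_closed [in A] /\ GRing.mulr_2closed [in A].

Definition interpolation_set (R : realType) (G : topologicalGroupType)
    (A : set (G -> R[i])) (T : set G) : Prop :=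
  forall f : T -> R[i], [bounded (f t : R[i]^o) | t in [set: T]] ->
    exists2 F : G -> R[i], A F & forall t : T, F (val t) = f t.

Definition approximable_interpolation_set (R : realType)
    (G : topologicalGroupType) (A : set (G -> R[i])) (T : set G) : Prop :=
  interpolation_set A T /\
  forall U : set G, nbhs (1%g : G) U ->
    exists V1 V2 : set G,
      [/\ open_nbhs (1%g : G) V1, open_nbhs (1%g : G) V2,
          closure V1 `<=` V2, V2 `<=` U &
          forall S : set G, S `<=` T ->
            exists2 h : G -> R[i], A h &
              h @` setmulg V1 S `<=` [set 1] /\
              h @` (~` setmulg V2 S) `<=` [set 0]].

Definition right_uniformly_discrete (G : topologicalGroupType) (T : set G)
    : Prop :=
  exists2 V : set G, nbhs (1%g : G) V &
    forall s t : G, T s -> T t -> s <> t ->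
      setmulg V [set s] `&` setmulg V [set t] = set0.

(* Main.v *)
Require Import Defs.
From HB Require Import structures.
From mathcomp Require Import all_boot all_order all_algebra.
From mathcomp Require Import complex.
From mathcomp Require Import all_classical all_reals all_analysis.

(** For the approximation property, if [h1] and [h2] separate [S `&` T1] and
    [S `&` T2], then [h1 + h2 - h1 * h2] separates [S]; no unit is needed.
    For interpolation, uniform discreteness yields [h] in the algebra with
    [h = 1] on [T1] and [h = 0] on [T2 `\` T1], and [h * F1 + (F2 - h * F2)]
    then glues an extension [F1] from [T1] with an extension [F2] from [T2]. *)

Local Open Scope classical_set_scope.

Set Implicit Arguments.
Unset Strict Implicit.
Unset Printing Implicit Defensive.

Import GRing.Theory.

Section subalgebra_theory.
Context {R : realType} {G : Type} {A : set (G -> R[i])}.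
Hypothesis subA : subalgebra A.

Lemma subalgebraD f g : A f -> A g -> A (fun x => f x + g x)%R.
Proof.
move=> Af Ag; have [[_ linA] _] := subA; move: (linA 1%R f g).
by rewrite scale1r !inE; exact.
Qed.

Lemma subalgebraB f g : A f -> A g -> A (fun x => f x - g x)%R.
Proof.
move=> Af Ag; have [[_ linA] _] := subA; move: (linA (-1)%R g f).
by rewrite scaleN1r addrC !inE; exact.
Qed.

Lemma subalgebraM f g : A f -> A g -> A (fun x => f x * g x)%R.
Proof. by move=> Af Ag; have [_ /(_ f g)] := subA; rewrite !inE; exact. Qed.

End subalgebra_theory.

Lemma setmulgS (G : groupType) (V V' S S' : set G) :
  V `<=` V' -> S `<=` S' -> setmulg V S `<=` setmulg V' S'.
Proof.
move=> VV' SS' _ [v Vv] [s Ss] <-.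
by exists v; [exact: VV'|exists s => //; exact: SS'].
Qed.

Lemma sub_setmulg (G : groupType) (V S : set G) :
  V 1%g -> S `<=` setmulg V S.
Proof. by move=> V1 s Ss; exists 1%g => //; exists s => //; rewrite mul1g. Qed.

(** Functions on [S] and [T] live on distinct subtypes, so [f] is restricted by composing it with
    the inclusion [incl]; the composite inherits every bound of [f]. *)
Lemma interpolation_subset (R : realType) (G : topologicalGroupType)
    (A : set (G -> R[i])) (S T : set G) (f : T -> R[i]) :
  S `<=` T -> interpolation_set A S ->
  [bounded (f t : R[i]^o) | t in [set: T]] ->
  exists2 F, A F & forall t : T, S (val t) -> F (val t) = f t.
Proof.
move=> ST iS bf.
pose incl (s : S) : T := SigSub (mem_set (ST _ (set_mem (valP s)))).
have [|F AF FE] := iS (f \o incl).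
  have [M [realM fM]] := bf.
  by exists M; split=> [|N MN s _]; [exact: realM|exact: (fM N MN)].
exists F => // t St; rewrite (FE (SigSub (mem_set St))) /=.
by congr f; exact: val_inj.
Qed.

(** Approximability of [T1] is used with [S := T1] and, as [U], the neighbourhood [V] that witnesses
    discreteness. Since [V2] lies in [V], no point of [T2] outside [T1] can fall into [V2 T1]. *)
Lemma approximable_separation (R : realType) (G : topologicalGroupType)
    (A : set (G -> R[i])) (T1 T2 : set G) :
  approximable_interpolation_set A T1 ->
  right_uniformly_discrete (T1 `|` T2) ->
  exists h, [/\ A h, forall t, T1 t -> h t = 1%R &
    forall t, T2 t -> ~ T1 t -> h t = 0%R].
Proof.
move=> [_ aT1] [V nV dV]; have [V1 [V2 [oV1 _ _ V2V]]] := aT1 V nV.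
move=> /(_ T1 (@subset_refl _ T1)) [h Ah [h1 h0]].
exists h; split => // t.
  move=> T1t; apply: h1; exists t => //.
  by apply: (sub_setmulg _ T1t); case: oV1.
move=> T2t nT1t; apply: h0; exists t => // -[v V2v [s T1s vst]].
have ts : t <> s by move=> ts; apply: nT1t; rewrite ts.
(* The point [t] itself lies in both translates: [t = 1 t] is in [V t] and [t = v s] is in [V s]. *)
have /seteqP[/(_ t) + _] := dV t s (or_intror T2t) (or_introl T1s) ts.
apply; split; first exact: (sub_setmulg (nbhs_singleton nV)) (erefl t).
by exists v; [exact: V2V|exists s].
Qed.

Theorem proposition5p2 (R : realType) (G : topologicalGroupType)
    (A : set (G -> R[i])) (T1 T2 : set G) :
  subalgebra A -> A `<=` LUC R G ->
  approximable_interpolation_set A T1 ->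
  approximable_interpolation_set A T2 ->
  right_uniformly_discrete (T1 `|` T2) ->
  approximable_interpolation_set A (T1 `|` T2).
Proof.
move=> subA _ aiT1 aiT2 dT; have [[iT1 aT1] [iT2 aT2]] := (aiT1, aiT2).
split=> [f bf|U nU].
  have [h [Ah h1 h0]] := approximable_separation aiT1 dT.
  have [F1 AF1 F1E] := interpolation_subset (@subsetUl _ T1 T2) iT1 bf.
  have [F2 AF2 F2E] := interpolation_subset (@subsetUr _ T1 T2) iT2 bf.
  (* The second summand is [(1 - h) * F2], expanded because the constant 1 may lie outside [A]. *)
  exists (fun x => h x * F1 x + (F2 x - h x * F2 x))%R.
    apply: (subalgebraD subA); first exact: (subalgebraM subA).
    by apply: (subalgebraB subA) => //; exact: (subalgebraM subA).
  move=> t; have [T1t|nT1t] := pselect (T1 (val t)).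
    by rewrite h1// F1E// !mul1r subrr addr0.
  have T2t : T2 (val t) by case: (set_mem (valP t)).
  by rewrite h0// F2E// !mul0r subr0 add0r.
have [V1 [V2 [oV1 oV2 V12 V2U H1]]] := aT1 U nU.
have [W1 [W2 [oW1 oW2 W12 W2U H2]]] := aT2 U nU.
(* Intersecting the inner neighbourhoods keeps both functions equal to 1 near their own parts of
   [S]; uniting the outer ones makes both vanish off [(V2 ∪ W2) S]. *)
exists (V1 `&` W1), (V2 `|` W2); split.
- exact: open_nbhsI.
- by case: oV2 oW2 => [? ?] [? ?]; split; [exact: openU|left].
- by move=> x /closureI[/V12 ? _]; left.
- by move=> x [/V2U|/W2U].
move=> S ST.
have [h Ah [h1 h0]] := H1 (S `&` T1) (@subIsetr _ S T1).
have [k Ak [k1 k0]] := H2 (S `&` T2) (@subIsetr _ S T2).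
(* This is [1 - (1 - h) * (1 - k)]: it equals 1 as soon as one of [h], [k] does, whatever the value
   of the other, and it is 0 where both vanish. *)
exists (fun x => h x + k x - h x * k x)%R.
  by apply: (subalgebraB subA); [exact: subalgebraD|exact: subalgebraM].
split=> _ [x Sx <-] /=.
  have [v [V1v W1v] [s Ss vsx]] := Sx.
  have [T1s|T2s] := ST s Ss.
    have -> : h x = 1%R by apply: h1; exists x => //; exists v => //; exists s.
    by rewrite mul1r addrK.
  have -> : k x = 1%R by apply: k1; exists x => //; exists v => //; exists s.
  by rewrite mulr1 addrC addKr.
have -> : h x = 0%R.
  apply: h0; exists x => // xVS; apply: Sx; move: xVS.
  by apply: setmulgS => [y|y []//]; left.
have -> : k x = 0%R.
  apply: k0; exists x => // xWS; apply: Sx; move: xWS.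
  by apply: setmulgS => [y|y []//]; right.
by rewrite mul0r addr0 subr0.
Qed.
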